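(* Let $A$ be a finite set of items and $\mathcal{F}$ an antimonotonic, triangulated and clique-safe family of itemsets over $A$ whose dependency graph $G$ is connected. Let $T$ be a junction tree of $G$ and let $B\subseteq A$. Let $C$ be the set consisting of the items of $B$ together with all items belonging to the inner separators of $B$ (with respect to $T$). Then $C$ is a safe set.
   Context: An itemset is a subset of $A=\{a_1,\dots,a_K\}$; $S_U(z)=1$ iff $z_i=1$ for all $a_i\in U$. $\mathcal{F}$ is antimonotonic if closed under subsets. A distribution $p$ on $\{0,1\}^K$ satisfies $\theta=(\theta_U)_{U\in\mathcal{F}}$ if $E_p[S_U]=\theta_U$ for all $U\in\mathcal{F}$; ''frequencies for $\mathcal{F}$'' are such $\theta$ satisfied by some distribution. $C\subseteq A$ is safe if for all frequencies $\theta$ for $\mathcal{F}$, every distribution $q$ on $\{0,1\}^C$ with $E_q[S_U]=\theta_U$ for all $U\in\mathcal{F}$, $U\subseteq C$, has an extension $p$ on $\{0,1\}^K$ (its marginal on the coordinates in $C$ equals $q$) satisfying $\theta$. The dependency graph $G$ has vertex set $A$ and edges $\{a_i,a_j\}$ ($i\ne j$) with $\{a_i,a_j\}\in\mathcal{F}$. $\mathcal{F}$ is triangulated if $G$ has no chordless cycle of length $\ge4$. $\mathcal{F}$ is clique-safe if for every maximal clique $V$ of $G$, every proper subset of $V$ belongs to $\mathcal{F}$. The clique graph has the maximal cliques of $G$ as vertices, two being adjacent iff they share an item. A junction tree is a spanning tree $T$ of the clique graph with the running intersection property: if two cliques contain an item, every clique on the $T$-path between them contains it. Each edge of $T$ is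 a separator, associated with the set of items common to its two cliques. Given $B$, choose for each $b\in B$ a clique $Q_b$ of $T$ with $b\in Q_b$; the inner separators are the separators lying on the $T$-path from $Q_b$ to $Q_c$ for some $b,c\in B$, where the cliques $Q_b$ are chosen so that the number of inner separators is as small as possible (the resulting set of inner separators does not depend on the minimising choice). *)

(* Defs.v *)
From HB Require Import structures.
From mathcomp Require Import all_boot all_order all_algebra.
From mathcomp Require Import boolp reals.

Set Implicit Arguments.
Unset Strict Implicit.
Unset Printing Implicit Defensive.

Import Order.TTheory GRing.Theory Num.Theory.
Local Open Scope ring_scope.

Definition cube (I : finType) : finType := {ffun I -> bool}.

Section Distributions.
Variable R : realType.

Definition is_distr (Z : finType) (p : Z -> R) : Prop :=
  (forall z, 0 <= p z) /\ \sum_z p z = 1.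

Definition expect (Z : finType) (p : Z -> R) (f : Z -> R) : R :=
  \sum_z p z * f z.

Definition covers (I : finType) (U : {set I}) (z : cube I) : R :=
  [forall i in U, z i]%:R.

Variable A : finType.

Definition items_of (C : {set A}) : finType := {a : A | a \in C}.

(* [U], assumed to be a subset of [C], as a set of coordinates of {0,1}^C. *)
Definition within (C U : {set A}) : {set items_of C} :=
  [set i : items_of C | val i \in U].

Definition restrict (C : {set A}) (z : cube A) : cube (items_of C) :=
  [ffun i : items_of C => z (val i)].

Definition marginal (C : {set A}) (p : cube A -> R) (y : cube (items_of C)) : R :=
  \sum_(z | restrict C z == y) p z.

(* A vector (theta_U) indexed by the U in F is encoded as a function on all
   itemsets of which only the values on F are ever used. *)
Definition satisfies (F : {set {set A}}) (p : cube A -> R)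
    (theta : {set A} -> R) : Prop :=
  forall U, U \in F -> expect p (covers U) = theta U.

Definition frequencies (F : {set {set A}}) (theta : {set A} -> R) : Prop :=
  exists p : cube A -> R, is_distr p /\ satisfies F p theta.

Definition safe (F : {set {set A}}) (C : {set A}) : Prop :=
  forall theta : {set A} -> R, frequencies F theta ->
  forall q : cube (items_of C) -> R, is_distr q ->
  (forall U, U \in F -> U \subset C -> expect q (covers (within C U)) = theta U) ->
  exists p : cube A -> R,
    [/\ is_distr p, marginal (C := C) p =1 q & satisfies F p theta].

End Distributions.

Section Graphs.
Variable V : finType.
Implicit Types (e : rel V) (X : {set V}).

Definition connected_graph e : Prop := forall x y, connect e x y.

Definition chordal e : Prop :=
  forall c : seq V, ucycle e c -> (4 <= size c)%N ->
  exists x y, [/\ x \in c, y \in c, e x y, y != next c x & x != next c y].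

Definition clique e X : bool :=
  [forall x in X, forall y in X, (x != y) ==> e x y].

Definition max_cliques e : {set {set V}} := [set X | maxset (clique e) X].

(* The vertices of the path from [x] to [y] are those of [x :: p]. *)
Definition simple_path e (x y : V) (p : seq V) : Prop :=
  [/\ path e x p, last x p = y & uniq (x :: p)].

(* [t] is a tree with vertex set [W], all of its edges being edges of [e]. *)
Definition spanning_tree (W : {set V}) e (t : rel V) : Prop :=
  [/\ symmetric t,
      forall x y, t x y -> [/\ x \in W, y \in W & e x y],
      {in W &, forall x y, connect t x y} &
      forall c : seq V, ucycle t c -> (size c < 3)%N].

End Graphs.

Section Itemsets.
Variable A : finType.
Implicit Types (F : {set {set A}}) (B : {set A}) (e : rel A)
  (T : rel {set A}) (Q : A -> {set A}).

Definition antimonotonic F : Prop :=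
  forall U W : {set A}, W \in F -> U \subset W -> U \in F.

Definition dependency F : rel A :=
  fun x y => (x != y) && ([set x; y] \in F).

Definition triangulated F : Prop := chordal (dependency F).

Definition clique_safe F : Prop :=
  forall W U : {set A}, W \in max_cliques (dependency F) ->
  U \proper W -> U \in F.

(* Adjacency in the clique graph, whose vertex set is [max_cliques e]. *)
Definition clique_adj : rel {set A} :=
  fun X Y => (X != Y) && (X :&: Y != set0).

Definition running_intersection e T : Prop :=
  forall (X Y : {set A}) (p : seq {set A}) (a : A),
  X \in max_cliques e -> Y \in max_cliques e -> a \in X -> a \in Y ->
  simple_path T X Y p -> forall Z, Z \in X :: p -> a \in Z.

Definition junction_tree e T : Prop :=
  spanning_tree (max_cliques e) clique_adj T /\ running_intersection e T.

(* A separator is an edge of the tree, represented as the unordered pair of its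
   end points; distinct edges may thus carry the same items and still count as
   distinct separators. *)
Definition path_separators (X : {set A}) (p : seq {set A}) :
    seq {set {set A}} :=
  pairmap (fun Y Z : {set A} => [set Y; Z]) X p.

Definition separator_items (s : {set {set A}}) : {set A} :=
  \bigcap_(X in s) X.

(* Only the values of [Q] on [B] are used. *)
Definition clique_choice e B Q : Prop :=
  forall b, b \in B -> Q b \in max_cliques e /\ b \in Q b.

Definition inner_separators T B Q : {set {set {set A}}} :=
  [set s | `[< exists (b c : A) (p : seq {set A}),
      [/\ b \in B, c \in B, simple_path T (Q b) (Q c) p &
          s \in path_separators (Q b) p] >]].

Definition minimal_choice e T B Q : Prop :=
  clique_choice e B Q /\
  forall Q', clique_choice e B Q' ->
    (#|inner_separators T B Q| <= #|inner_separators T B Q'|)%N.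

End Itemsets.

(* Main.v *)
(** Let [p0] be a distribution satisfying [theta].  If [p] satisfies the
    frequencies supported by [D] and the neighbours in [D] of an item
    [v \notin D] form a clique [N], redrawing the coordinate [v] of [p] from its
    conditional law under [p0] given [N] yields a distribution with the same
    marginal off [v] which satisfies the frequencies supported by [v |: D]: by
    clique-safety all subsets of [N] are in [F], so [p] and [p0] have the same
    marginal on [N].  It remains to reach [A] from [C] by adding such items one at
    a time.  The cliques joined by the inner separators form a subtree [S] of
    [T], and an item of [cover S] outside [C] lies in only one clique of [S],
    which by running intersection contains all its neighbours in [cover S].
    Once [cover S] is exhausted, [S] is enlarged by an adjacent clique. *)

Require Import Defs.
From mathcomp Require Import all_boot all_order all_algebra.
From mathcomp Require Import boolp reals.

Set Implicit Arguments.
Unset Strict Implicit.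
Unset Printing Implicit Defensive.

Import Order.TTheory GRing.Theory Num.Theory.
Local Open Scope ring_scope.

(** * Redrawing one coordinate from a conditional law *)

Section Resampling.
Variables (R : realType) (A : finType).
Implicit Types (p : cube A -> R) (N U M P : {set A}) (v : A) (y z : cube A).

Definition agree N y z : bool := [forall i in N, y i == z i].

Definition flip v z : cube A := [ffun i => if i == v then ~~ z i else z i].

Definition mass p N z : R := \sum_(y | agree N y z) p y.

(* The law of [p] after redrawing the coordinate [v] from its conditional law
   under [p0] given [N].  The junk value [x / 0 = 0] is harmless as long as [p]
   and [p0] have the same marginal on [N]. *)
Definition resample p0 N v p z : R :=
  (p z + p (flip v z)) * (mass p0 (v |: N) z / mass p0 N z).

Lemma agree_sym N y z : agree N y z = agree N z y.
Proof. by apply: eq_forallb_in => i _; rewrite eq_sym. Qed.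

Lemma agree_trans N : transitive (agree N).
Proof.
move=> y x z /forall_inP xy /forall_inP yz; apply/forall_inP => i iN.
by rewrite (eqP (xy i iN)) yz.
Qed.

Lemma agreeU1 v N y z : agree (v |: N) y z = (y v == z v) && agree N y z.
Proof.
apply/forall_inP/andP => [h|[yv /forall_inP h] i].
  split; first by rewrite h ?setU11.
  by apply/forall_inP => i iN; rewrite h // in_setU1 iN orbT.
by rewrite in_setU1 => /orP [/eqP -> //|/h].
Qed.

Lemma flipK v : involutive (flip v).
Proof. by move=> z; apply/ffunP => i; rewrite !ffunE; case: eqP; rewrite ?negbK. Qed.

Lemma flip_out v z i : i != v -> flip v z i = z i.
Proof. by rewrite ffunE => /negbTE ->. Qed.

Lemma flip_at v z : flip v z v = ~~ z v.
Proof. by rewrite ffunE eqxx. Qed.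

Lemma agree_flip v N y z : v \notin N -> agree N y (flip v z) = agree N y z.
Proof.
move=> vN; apply: eq_forallb_in => i iN.
by rewrite flip_out //; apply: contraNneq vN => <-.
Qed.

Lemma agree_flipl v N y z : v \notin N -> agree N (flip v y) z = agree N y z.
Proof. by move=> vN; rewrite agree_sym agree_flip // agree_sym. Qed.

Lemma mass_agree p N y z : agree N y z -> mass p N y = mass p N z.
Proof.
move=> yz; apply: eq_bigl => x; apply/idP/idP => h.
  exact: agree_trans h yz.
by apply: agree_trans h _; rewrite agree_sym.
Qed.

Lemma mass_ge0 p N z : (forall z, 0 <= p z) -> 0 <= mass p N z.
Proof. by move=> p0; apply: sumr_ge0. Qed.

Lemma mass_eq0 p N y z : (forall z, 0 <= p z) -> mass p N z = 0 ->
  agree N y z -> p y = 0.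
Proof. by move=> p0 /psumr_eq0P h yz; apply: h. Qed.

Lemma mass_split p N v z : v \notin N ->
  mass p (v |: N) z + mass p (v |: N) (flip v z) = mass p N z.
Proof.
move=> vN; rewrite [RHS](bigID (fun y : cube A => y v == z v)) /=.
congr (_ + _); apply: eq_bigl => y; rewrite agreeU1 andbC //.
by rewrite flip_at agree_flip //; case: (y v); case: (z v).
Qed.

(** [f] is constant on each pair [z], [flip v z], so only the total weight of the pair matters.
    Doubling the sums avoids choosing a representative of each pair. *)
Lemma sum_flip_invariant p p' v (f : cube A -> R) :
  (forall z, p' z + p' (flip v z) = p z + p (flip v z)) ->
  (forall z, f (flip v z) = f z) ->
  \sum_z p' z * f z = \sum_z p z * f z.
Proof.
move=> pp' fv.
have twice r : (\sum_z r z * f z) *+ 2 = \sum_z (r z + r (flip v z)) * f z.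
  rewrite mulr2n {2}(reindex_inj (inv_inj (flipK v))) /= -big_split /=.
  by apply: eq_bigr => z _; rewrite fv mulrDl.
have : (\sum_z p' z * f z) *+ 2 = (\sum_z p z * f z) *+ 2.
  by rewrite !twice; apply: eq_bigr => z _; rewrite pp'.
by move/eqP; rewrite eqrMn2r /= => /eqP.
Qed.

Lemma resample_ge0 p0 p N v z : (forall z, 0 <= p0 z) -> (forall z, 0 <= p z) ->
  0 <= resample p0 N v p z.
Proof.
by move=> p0_ge0 p_ge0; rewrite mulr_ge0 ?addr_ge0 ?divr_ge0 ?mass_ge0.
Qed.

Section SameMass.
Variables (p0 p : cube A -> R) (N : {set A}) (v : A).
Hypotheses (p0_ge0 : forall z, 0 <= p0 z) (p_ge0 : forall z, 0 <= p z).
Hypotheses (vN : v \notin N) (same : forall z, mass p N z = mass p0 N z).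

(** The ratios at [z] and [flip v z] share their denominator, and their numerators add up to it by
    [mass_split]. *)
Lemma resample_flip z :
  resample p0 N v p z + resample p0 N v p (flip v z) = p z + p (flip v z).
Proof.
rewrite /resample flipK [p (flip v z) + _]addrC -mulrDr.
have -> : mass p0 N (flip v z) = mass p0 N z.
  by apply: mass_agree; rewrite agree_flipl //; apply/forall_inP.
rewrite -mulrDl mass_split //.
(* If the denominator vanishes, equality of the masses makes [p] vanish at both points. *)
have [m0|m0] := eqVneq (mass p0 N z) 0; last by rewrite divff // mulr1.
have m0' : mass p N z = 0 by rewrite same.
have azz : agree N z z by apply/forall_inP.
rewrite (mass_eq0 p_ge0 m0' azz) (mass_eq0 p_ge0 m0' (y := flip v z)).
  by rewrite addr0 mul0r.
by rewrite agree_flipl.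
Qed.

(* Both sides sum [p0 y * f y] times the ratio of the [N]-masses of [y] under
   [p] and [p0]. *)
Lemma resample_local (f : cube A -> R) :
  (forall y z, agree (v |: N) y z -> f y = f z) ->
  \sum_z resample p0 N v p z * f z = \sum_z p0 z * f z.
Proof.
move=> fl.
transitivity (\sum_z \sum_(y | agree (v |: N) y z)
    (p z + p (flip v z)) * (p0 y * f y / mass p0 N y)).
  apply: eq_bigr => z _; rewrite -mulr_sumr /resample -!mulrA; congr (_ * _).
  rewrite {1}/mass !mulr_suml; apply: eq_bigr => y yz.
  have -> : mass p0 N y = mass p0 N z.
    by apply: mass_agree; move: yz; rewrite agreeU1 => /andP [].
  by rewrite (fl _ _ yz) -!mulrA [_^-1 * _]mulrC.
rewrite (exchange_big_dep predT) //=; apply: eq_bigr => y _.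
rewrite -mulr_suml.
have -> : \sum_(z | agree (v |: N) y z) (p z + p (flip v z)) = mass p0 N y.
  rewrite -same -(mass_split p y vN) big_split /=; congr (_ + _).
    by apply: eq_bigl => z; rewrite agree_sym.
  rewrite (reindex_inj (inv_inj (flipK v))) /=.
  apply: eq_big => [z|z _]; last by rewrite flipK.
  rewrite !agreeU1 !flip_at !agree_flip // agree_sym.
  by case: (y v); case: (z v).
have [m0|m0] := eqVneq (mass p0 N y) 0; last by rewrite mulrC divfK.
have azz : agree N y y by apply/forall_inP.
by rewrite m0 (mass_eq0 p0_ge0 m0 azz) !mul0r.
Qed.

End SameMass.

(** * Marginals from frequencies *)

Definition vanish M z : bool := [forall i in M, ~~ z i].

(** Inclusion-exclusion: the absence of an item [i] of [M] is 1 minus its presence, so removing [i]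
    from [M] leaves a difference of two terms, the second with [i] moved to [P]. *)
Lemma covers_vanish_eq p p' N :
  (forall U, U \subset N -> expect p (covers R U) = expect p' (covers R U)) ->
  forall M P, M \subset N -> P \subset N ->
  expect p (fun z => covers R P z * (vanish M z)%:R)
  = expect p' (fun z => covers R P z * (vanish M z)%:R).
Proof.
move=> same M; have [k] := ubnP #|M|; elim: k M => // k IH M leM P MN PN.
have [->|[i iM]] := set_0Vmem M.
  have v0 z : vanish set0 z by apply/forall_inP => i; rewrite inE.
  have E r : expect r (fun z => covers R P z * (vanish set0 z)%:R)
    = expect r (covers R P).
    by apply: eq_bigr => z _; rewrite v0 mulr1.
  by rewrite !E same.
have split r : expect r (fun z => covers R P z * (vanish M z)%:R)
    = expect r (fun z => covers R P z * (vanish (M :\ i) z)%:R)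
    - expect r (fun z => covers R (i |: P) z * (vanish (M :\ i) z)%:R).
  rewrite /expect -sumrB; apply: eq_bigr => z _; rewrite -mulrBr; congr (_ * _).
  have -> : vanish M z = ~~ z i && vanish (M :\ i) z.
    apply/forall_inP/andP => [h|[zi /forall_inP h] j jM].
      by split; [exact: h|apply/forall_inP => j /setD1P [_ /h]].
    by have [->//|ji] := eqVneq j i; apply: h; rewrite in_setD1 ji.
  have -> : covers R (i |: P) z = (z i && [forall j in P, z j])%:R.
    congr (_%:R); congr nat_of_bool.
    apply/forall_inP/andP => [h|[zi /forall_inP h] j].
      split; first by rewrite h ?setU11.
      by apply/forall_inP => j jP; rewrite h // in_setU1 jP orbT.
    by rewrite in_setU1 => /orP [/eqP ->|/h].
  rewrite /covers; case: (z i); case: [forall j in P, z j];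
    by rewrite ?mul1r ?mul0r ?mulr1 ?subr0 ?subrr.
have ltM : (#|M :\ i| < k)%N by move: leM; rewrite (cardsD1 i M) iM.
have MiN : M :\ i \subset N by apply: subset_trans MN; apply: subD1set.
rewrite !split !IH //.
by rewrite subUset sub1set PN andbT (subsetP MN).
Qed.

(* Moebius inversion: the frequencies of the subsets of [N] determine the
   marginal on [N]. *)
Lemma covers_mass p p' N :
  (forall U, U \subset N -> expect p (covers R U) = expect p' (covers R U)) ->
  forall z, mass p N z = mass p' N z.
Proof.
move=> same z.
(* Agreement with [z] on [N] means that the items of [N] true in [z] are all present and the others
   all absent. *)
have E r : mass r N z = expect r (fun y =>
    covers R [set i in N | z i] y * (vanish [set i in N | ~~ z i] y)%:R).
  rewrite /mass big_mkcond; apply: eq_bigr => y _.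
  rewrite /covers -natrM mulnb.
  have -> : agree N y z = [forall i in [set i in N | z i], y i]
      && vanish [set i in N | ~~ z i] y.
    apply/forall_inP/andP => [h|[/forall_inP h1 /forall_inP h0] i iN].
      split; apply/forall_inP => i; rewrite inE => /andP [iN zi].
        by rewrite (eqP (h i iN)).
      by rewrite (eqP (h i iN)).
    have := h1 i; have := h0 i; rewrite !inE iN /=.
    by case: (z i); case: (y i) => //= h h'; rewrite ?h ?h' // eqxx.
  by case: (_ && _); rewrite ?mulr1 ?mulr0.
rewrite !E; apply: (covers_vanish_eq same);
  by apply/subsetP => i; rewrite inE => /andP [].
Qed.

End Resampling.

(** * Extending a distribution by one item *)

Section Extension.
Variables (R : realType) (A : finType).
Implicit Types (p q : cube A -> R) (F : {set {set A}}) (C D U N : {set A}).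

Lemma covers_flip U v z : v \notin U -> covers R U (flip v z) = covers R U z.
Proof.
move=> vU; congr (_%:R); congr nat_of_bool.
apply: eq_forallb_in => i iU; rewrite flip_out //.
by apply: contraNneq vU => <-.
Qed.

Lemma covers_local U N y z : U \subset N -> agree N y z ->
  covers R U y = covers R U z.
Proof.
move=> /subsetP UN /forall_inP yz; congr (_%:R); congr nat_of_bool.
by apply: eq_forallb_in => i /UN /yz /eqP ->.
Qed.

Lemma restrict_flip C v (z : cube A) : v \notin C ->
  restrict C (flip v z) = restrict C z.
Proof.
move=> vC; apply/ffunP => i; rewrite !ffunE.
by case: eqP => // iv; case/negP: vC; rewrite -iv (valP i).
Qed.

Lemma marginalE C p (y : cube (items_of C)) :
  marginal p y = \sum_z p z * (restrict C z == y)%:R.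
Proof.
rewrite /marginal big_mkcond; apply: eq_bigr => z _.
by case: eqP; rewrite ?mulr1 ?mulr0.
Qed.

(* [p] lives on the whole cube; its coordinates outside [D] are arbitrary. *)
Definition extends_to F C (theta : {set A} -> R) (q : cube (items_of C) -> R) D
    : Prop :=
  exists p, [/\ is_distr p, marginal (C := C) p =1 q &
    forall U, U \in F -> U \subset D -> expect p (covers R U) = theta U].

(** The witness is the push-forward of [q] under [embed], which fills the coordinates outside [C]
    with [false]. *)
Lemma extends_to_base F C theta (q : cube (items_of C) -> R) :
  is_distr q ->
  (forall U, U \in F -> U \subset C ->
     expect q (covers R (within C U)) = theta U) ->
  extends_to F theta q C.
Proof.
move=> [q_ge0 q_sum] q_theta.
pose embed (y : cube (items_of C)) : cube A :=
  [ffun a => if insub a is Some i then y i else false].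
have embed_val y i : embed y (val i) = y i by rewrite ffunE valK.
pose p z := \sum_(y | embed y == z) q y.
have pE (f : cube A -> R) : \sum_z p z * f z = \sum_y q y * f (embed y).
  rewrite [RHS](partition_big embed predT) //=; apply: eq_bigr => z _.
  by rewrite mulr_suml; apply: eq_bigr => y /eqP ->.
exists p; split.
- split=> [z|]; first exact: sumr_ge0.
  rewrite -q_sum -[RHS](eq_bigr _ (fun y _ => mulr1 (q y))) -(pE (fun=> 1)).
  by apply: eq_bigr => z _; rewrite mulr1.
- move=> y; rewrite marginalE pE (bigD1 y) //= big1 ?addr0.
    rewrite (_ : restrict C _ = y) ?eqxx ?mulr1 //.
    by apply/ffunP => i; rewrite ffunE embed_val.
  move=> y' /negbTE yy'.
  rewrite (_ : restrict C _ = y') ?yy' ?mulr0 //.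
  by apply/ffunP => i; rewrite ffunE embed_val.
- move=> U UF UC; rewrite -q_theta // /expect pE.
  apply: eq_bigr => y _; congr (_ * _%:R); congr nat_of_bool.
  apply/forall_inP/forall_inP => [h i|h a aU].
    by rewrite inE => /h; rewrite embed_val.
  have aC := subsetP UC a aU.
  rewrite -[a]/(val (Sub a aC : items_of C)) embed_val.
  by apply: h; rewrite inE.
Qed.

(** Resampling at [v] preserves every sum that ignores the coordinate [v]: the total mass, the
    marginal on [C] and the frequencies of itemsets avoiding [v]. Itemsets containing [v] get their
    frequencies from [p0]. *)
Lemma extends_to_step F C theta (q : cube (items_of C) -> R) D v :
  antimonotonic F -> clique_safe F -> frequencies F theta ->
  C \subset D -> v \notin D ->
  clique (dependency F) [set w in D | dependency F v w] ->
  extends_to F theta q D -> extends_to F theta q (v |: D).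
Proof.
move=> F_anti F_safe [p0 [[p0_ge0 p0_sum] p0_theta]] CD vD.
set N := [set w in D | _] => cliqueN [p [[p_ge0 p_sum] p_q p_theta]].
have vN : v \notin N by rewrite inE (negbTE vD).
(* A maximal clique containing the clique [v |: N] has [v] as an item outside [U], so clique-safety
   applies to [U]. *)
have subN U : U \subset N -> U \in F.
  move=> UN.
  have cl : clique (dependency F) (v |: N).
    apply/forall_inP => x; rewrite in_setU1 => xvN.
    apply/forall_inP => y; rewrite in_setU1 => yvN; apply/implyP => xy.
    case/orP: xvN => [/eqP ex|xN]; case/orP: yvN => [/eqP ey|yN].
    - by rewrite ex ey eqxx in xy.
    - by move: yN; rewrite inE ex => /andP [].
    - move: xN; rewrite inE ey => /andP [_].
      by rewrite /dependency eq_sym setUC.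
    - by have /implyP := forall_inP (forall_inP cliqueN x xN) y yN; apply.
  have [W maxW subW] := maxset_exists cl.
  apply: (F_safe W); first by rewrite inE.
  apply/properP; split.
    by apply: subset_trans UN (subset_trans _ subW); apply: subsetUr.
  exists v; first by rewrite (subsetP subW) ?setU11.
  by apply: contra vN; apply: (subsetP UN).
have same z : mass p N z = mass p0 N z.
  apply: covers_mass => U UN; rewrite p0_theta ?subN // p_theta ?subN //.
  by apply: subset_trans UN _; apply/subsetP => w; rewrite inE => /andP [].
pose p' := resample p0 N v p.
have p'_flip z := resample_flip p_ge0 vN same z.
have p'E := sum_flip_invariant p'_flip.
exists p'; split.
- split=> [z|]; first exact: resample_ge0.
  have /= := p'E (fun=> 1) (fun=> erefl).
  rewrite (eq_bigr _ (fun z _ => mulr1 (p' z))).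
  by rewrite (eq_bigr _ (fun z _ => mulr1 (p z))) p_sum.
- move=> y; rewrite -p_q !marginalE p'E // => z.
  by rewrite restrict_flip //; apply: contra vD; apply: (subsetP CD).
- move=> U UF UvD; have [vU|vU] := boolP (v \in U); last first.
    rewrite /expect p'E => [|z]; last exact: covers_flip.
    apply: p_theta => //; apply/subsetP => w wU.
    have := subsetP UvD w wU; rewrite in_setU1 => /orP [/eqP wv|//].
    by rewrite -wv wU in vU.
  (* By antimonotonicity each item of [U] other than [v] is a neighbour of [v], so [U] lies in
     [v |: N]. *)
  rewrite -p0_theta // /expect resample_local // => y z.
  apply: covers_local; apply/subsetP => w wU.
  have [->|wv] := eqVneq w v; first exact: setU11.
  have := subsetP UvD w wU; rewrite !in_setU1 (negbTE wv) /= => wD.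
  rewrite inE wD /dependency eq_sym wv /=.
  by apply: F_anti UF _; rewrite subUset !sub1set vU.
Qed.

End Extension.

(** * Subtrees of the junction tree and the order of adding items *)

Section SimplicialExtension.
Variables (A : finType) (e : rel A) (T : rel {set A}).
Hypotheses (e_sym : symmetric e) (jT : junction_tree e T).
Implicit Types (C D X Y Z : {set A}) (S : {set {set A}}) (a v w : A).

(** The vertex sets of subtrees of [T], the empty one included. *)
Definition linked S : Prop :=
  S \subset max_cliques e /\
  {in S &, forall X Y, exists2 p, simple_path T X Y p & {subset p <= S}}.

Lemma connect_simple (V : finType) (r : rel V) x y :
  connect r x y -> exists p, simple_path r x y p.
Proof.
move/connectP => [p pp ->]; case/shortenP: pp => p' pp' up' _.
by exists p'.
Qed.

Lemma edge_max_clique v w : e v w ->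
  exists X, [/\ X \in max_cliques e, v \in X & w \in X].
Proof.
move=> vw.
have cl : clique e [set v; w].
  apply/forall_inP => x xvw; apply/forall_inP => y yvw; apply/implyP.
  move: xvw yvw; rewrite !inE.
  by case/orP => /eqP ->; case/orP => /eqP ->; rewrite ?eqxx // e_sym.
have [X maxX subX] := maxset_exists cl.
by exists X; rewrite inE maxX !(subsetP subX) ?set21 ?set22.
Qed.

Lemma in_max_clique a : exists2 X, X \in max_cliques e & a \in X.
Proof.
have cl : clique e [set a].
  apply/forall_inP => x /set1P ->; apply/forall_inP => y /set1P ->.
  by rewrite eqxx.
have [X maxX subX] := maxset_exists cl.
by exists X; [rewrite inE|rewrite (subsetP subX) ?set11].
Qed.

Lemma max_clique_clique X : X \in max_cliques e -> clique e X.
Proof. by rewrite inE => /maxsetp. Qed.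

(* [Z] is where a tree path from [Y] first enters [S]: prolonged inside [S], it
   gives a simple path from [Y] to any member of [S]. *)
Lemma gate S Y : linked S -> S != set0 -> Y \in max_cliques e ->
  exists2 Z, Z \in S &
  forall a X, a \in Y -> a \in X -> X \in S -> a \in Z.
Proof.
move=> [/subsetP SW S_conn] /set0Pn [X0 X0S] YW.
have [[_ _ T_conn _] rip] := jT.
have [p [pT plast puniq]] := connect_simple (T_conn _ _ YW (SW _ X0S)).
have : has (mem S) (Y :: p).
  by apply/hasP; exists X0 => //; rewrite -plast mem_last.
rewrite /= => /orP [YS|hasp]; first by exists Y.
have [YS|YS] := boolP (Y \in S); first by exists Y.
(* The path is cut at its first vertex [Z] in [S]; the part [p1] before [Z] avoids [S], so any
   simple path from [Z] inside [S] can be appended. *)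
move: pT puniq; rewrite -(cat_take_drop (find (mem S) p) p).
rewrite (drop_nth Y) -?has_find //.
set Z := nth _ _ _; set p1 := take _ _; set p2 := drop _ _.
have ZS : Z \in S by exact: nth_find.
have p1S : {in p1, forall X, X \notin S}.
  move=> X /(nthP Y) [i]; rewrite size_take -has_find hasp => ip <-.
  by rewrite nth_take //; apply/negbT/before_find.
rewrite -cat_rcons cat_path -cat_cons cat_uniq => /andP [p1T _] /and3P [u1 _ _].
exists Z => // a X aY aX XS.
have [r [rT rlast runiq] rS] := S_conn Z X ZS XS.
apply: (rip Y X (rcons p1 Z ++ r)) => //; first exact: SW.
  split.
  - by rewrite cat_path p1T last_rcons.
  - by rewrite last_cat last_rcons.
  - rewrite -cat_cons cat_uniq u1 /=; move: runiq => /= /andP [Zr ->].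
    rewrite andbT; apply/hasPn => X' X'r /=.
    rewrite inE mem_rcons inE !negb_or; apply/and3P; split.
    + by apply: contraNneq YS => <-; apply: rS.
    + by apply: contraNneq Zr => <-.
    + by apply: contraL (rS _ X'r); apply: p1S.
by rewrite inE mem_cat mem_rcons !inE eqxx !orbT.
Qed.

(** It makes an item of [cover S] outside [D] lie in exactly one clique of [S]. *)
Definition separated S D : Prop :=
  D \subset cover S /\
  {in S &, forall X Y, X != Y -> X :&: Y \subset D}.

(** Let [X] be the only clique of [S] containing [v]. A maximal clique through [v] and a neighbour
    [w] in [D] has a gate in [S] containing both, and this gate must be [X]. So all these neighbours
    lie in the clique [X]. *)
Lemma separated_clique S D v : linked S -> separated S D ->
  v \in cover S -> v \notin D -> clique e [set w in D | e v w].
Proof.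
move=> S_link [/subsetP DS sepS] /bigcupP [X XS vX] vD.
suff /subsetP NX : [set w in D | e v w] \subset X.
  have /forall_inP cX := max_clique_clique (subsetP (proj1 S_link) X XS).
  apply/forall_inP => x /NX xX; apply/forall_inP => y /NX yX.
  exact: (forall_inP (cX x xX)).
apply/subsetP => w; rewrite inE => /andP [wD vw].
have /bigcupP [X' X'S wX'] := DS w wD.
have [Y [YW vY wY]] := edge_max_clique vw.
have S0 : S != set0 by apply/set0Pn; exists X.
have [Z ZS gateZ] := gate S_link S0 YW.
have vZ := gateZ v X vY vX XS.
have wZ := gateZ w X' wY wX' X'S.
have [<-//|ZX] := eqVneq Z X.
by case/negP: vD; apply: (subsetP (sepS Z X ZS XS ZX)); rewrite inE vZ.
Qed.

Lemma separated_add S D v : separated S D -> v \in cover S ->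
  separated S (v |: D).
Proof.
move=> [DS sepS] vS; split; first by rewrite subUset sub1set vS.
by move=> X Y XS YS XY; apply: subset_trans (sepS _ _ XS YS XY) (subsetUr _ _).
Qed.

Lemma crossing_edge (V : finType) (r : rel V) (S : {set V}) x p :
  path r x p -> x \in S -> last x p \notin S ->
  exists y z, [/\ y \in S, z \notin S & r y z].
Proof.
elim: p x => [|z p IH] x /=; first by move=> _ ->.
move=> /andP [xz zp] xS; have [zS|zS _] := boolP (z \in S).
  exact: IH zp zS.
by exists x, z.
Qed.

(** A tree path leaving [S] crosses an edge from some [X] in [S] to a [Y] outside; prefixing this
    edge to a simple path from [X] inside [S] keeps it simple. *)
Lemma linked_grow S : linked S -> S != max_cliques e ->
  exists2 Y, Y \notin S & linked (Y |: S).
Proof.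
move=> [SW S_conn] SnW.
have [[T_sym T_in T_conn _] _] := jT.
have /properP [_ [Y0 Y0W Y0S]] : S \proper max_cliques e.
  by rewrite properEneq SnW.
have [S0|[X0 X0S]] := set_0Vmem S.
  exists Y0 => //; split; first by rewrite subUset sub1set Y0W.
  by move=> X Y; rewrite S0 setU0 => /set1P -> /set1P ->; exists [::].
have /connectP [p pT plast] := T_conn _ _ (subsetP SW _ X0S) Y0W.
rewrite plast in Y0S.
have [X [Y [XS YS XY]]] := crossing_edge pT X0S Y0S.
have [_ YW _] := T_in _ _ XY.
have Y_to Z : Z \in S ->
    exists2 p, simple_path T Y Z p & {subset p <= Y |: S}.
  move=> ZS; have [r [rT rlast runiq] rS] := S_conn X Z XS ZS.
  have sub : {subset X :: r <= S} by move=> W /predU1P [->|/rS].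
  exists (X :: r); last by move=> W /sub WS; rewrite in_setU1 WS orbT.
  split=> //; first by rewrite /= T_sym XY.
  by rewrite cons_uniq runiq andbT; apply: contra YS => /sub.
exists Y => //; split; first by rewrite subUset sub1set YW.
move=> Z Z'; rewrite !in_setU1.
case/predU1P => [->|ZS]; case/predU1P => [->|Z'S].
- by exists [::].
- exact: Y_to.
- have [r [rT rlast runiq] rS] := Y_to Z ZS.
  (* The path [Y :: r] read backwards, without its new starting point [Z]. *)
  exists (rev (belast Y r)).
    split.
    + rewrite -rlast rev_path (eq_path (e' := T)) // => x y; exact: T_sym.
    + by case: (r) rlast => [<-//|x r' _]; rewrite /= rev_cons last_rcons.
    + by rewrite -rev_rcons rev_uniq -rlast -lastI.
  move=> W; rewrite mem_rev => /mem_belast; rewrite inE => /predU1P [->|/rS //].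
  exact: setU11.
- have [r rZ rS] := S_conn Z Z' ZS Z'S.
  by exists r => // W /rS WS; rewrite in_setU1 WS orbT.
Qed.

(** Induction on the number of items outside [D] plus the number of sets outside [S']: an item of
    [cover S'] is added to [D] while one is missing, and otherwise [S'] grows. *)
Lemma simplicial_extension S C (P : {set A} -> Prop) :
  linked S -> separated S C -> P C ->
  (forall D v, C \subset D -> v \notin D ->
     clique e [set w in D | e v w] -> P D -> P (v |: D)) ->
  P [set: A].
Proof.
move=> S_link sepSC PC P_step.
suff H n D S' : (#|~: D| + #|~: S'| < n)%N -> C \subset D -> linked S' ->
    separated S' D -> P D -> P [set: A].
  exact: (H _ C S (leqnn _)).
elim: n D S' => // n IH D S' lt CD S'_link sepD PD.
have [DS|] := boolP (cover S' \subset D); last first.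
  case/subsetPn => v vS vD.
  apply: (IH (v |: D) S') => //.
  - apply: leq_trans (_ : #|~: D| + #|~: S'| <= n)%N => //.
    rewrite ltn_add2r proper_card // setCU setIC -setDE.
    by rewrite properD1 // inE.
  - by apply: subset_trans CD (subsetUr _ _).
  - exact: separated_add.
  - apply: P_step => //; exact: separated_clique S'_link sepD vS vD.
have [S'W|S'W] := eqVneq S' (max_cliques e).
  suff <- : D = [set: A] by [].
  apply/eqP; rewrite -subTset; apply: subset_trans DS.
  apply/subsetP => a _; have [X XW aX] := in_max_clique a.
  by apply/bigcupP; exists X; rewrite // S'W.
have [Y YS' Y_link] := linked_grow S'_link S'W.
apply: (IH D (Y |: S')) => //.
  apply: leq_trans (_ : #|~: D| + #|~: S'| <= n)%N => //.
  rewrite ltn_add2l proper_card // setCU setIC -setDE.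
  by rewrite properD1 // inE.
(* Old cliques lie wholly in [D], and so do their intersections with the new clique [Y]. *)
have subS' X : X \in S' -> X \subset D.
  by move=> XS'; apply: subset_trans DS; apply: bigcup_sup.
case: sepD => DS' sepD; split.
  by apply: subset_trans DS' _; rewrite /cover; apply/bigcupsP => X XS';
    apply: bigcup_sup; rewrite in_setU1 XS' orbT.
move=> X X'; rewrite !in_setU1.
case/predU1P => [->|/subS' XS']; case/predU1P => [->|/subS' X'S'].
- by rewrite eqxx.
- by move=> _; rewrite subIset // X'S' orbT.
- by move=> _; rewrite subIset // XS'.
- by move=> _; rewrite subIset // XS'.
Qed.

End SimplicialExtension.

(** * The subtree spanned by the inner separators *)

Section InnerSeparators.
Variables (A : finType) (e : rel A) (T : rel {set A}).
Variables (B : {set A}) (Q : A -> {set A}).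
Hypotheses (jT : junction_tree e T) (Q_choice : clique_choice e B Q).
Implicit Types (X Y : {set A}) (p : seq {set A}).

Let inner := inner_separators T B Q.

Definition inner_edge : rel {set A} :=
  fun X Y => T X Y && ([set X; Y] \in inner).

Lemma inner_edge_path X p : path T X p ->
  {subset path_separators X p <= inner} -> path inner_edge X p.
Proof.
elim: p X => //= Y p IH X /andP [XY Yp] sub.
rewrite /inner_edge XY sub ?mem_head //=.
by apply: IH => // s sp; apply: sub; rewrite inE sp orbT.
Qed.

Lemma inner_path b c p : b \in B -> c \in B ->
  simple_path T (Q b) (Q c) p -> path inner_edge (Q b) p.
Proof.
move=> bB cB pP; apply: inner_edge_path; first by case: pP.
by move=> s sp; rewrite inE; apply/asboolP; exists b, c, p.
Qed.

Lemma path_separators_source X p s : s \in path_separators X p ->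
  exists2 Y, Y \in X :: p & Y \in s.
Proof.
elim: p X => //= Y p IH X; rewrite inE => /predU1P [->|/IH [Z Zp Zs]].
  by exists X; rewrite ?mem_head ?set21.
by exists Z => //; rewrite inE Zp orbT.
Qed.

(** The subtree is the component of one [Q b0] under [inner_edge]. It contains every [Q b], since
    the tree path from [Q b0] to [Q b] crosses inner separators only. *)
Lemma inner_subtree :
  exists2 S, linked e T S &
  separated S (B :|: \bigcup_(s in inner) separator_items s).
Proof.
have [[T_sym T_in T_conn _] rip] := jT.
have [B0|[b0 b0B]] := set_0Vmem B.
  exists set0; first by split; [exact: sub0set|move=> X Y; rewrite inE].
  split; last by move=> X Y; rewrite inE.
  rewrite B0 set0U; apply/bigcupsP => s; rewrite inE.
  by move/asboolP => [b [_ [_ [bB _ _ _]]]]; rewrite B0 inE in bB.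
have E_sym : symmetric inner_edge.
  by move=> X Y; rewrite /inner_edge T_sym setUC.
have QW b (bB : b \in B) := proj1 (Q_choice bB).
have ET X p : path inner_edge X p -> path T X p.
  by apply: sub_path => Y Z /andP [].
pose S := [set X in max_cliques e | connect inner_edge (Q b0) X].
have S_path X p : X \in S -> path inner_edge X p -> {subset X :: p <= S}.
  move=> XS pE Y; elim: p X XS pE => [|Z p IH] X XS /=.
    by move=> _; rewrite inE => /eqP ->.
  move=> /andP [XZ Zp]; rewrite inE => /predU1P [->//|]; apply: IH => //.
  case/andP: (XZ) => /T_in [_ ZW _] _; move: XS.
  rewrite ![_ \in S]in_set ZW => /andP [_ b0X].
  exact: connect_trans b0X (connect1 XZ).
have S_conn X Y : X \in S -> Y \in S ->
    exists p, simple_path inner_edge X Y p.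
  rewrite ![_ \in S]in_set => /andP [_ X0] /andP [_ Y0].
  apply: connect_simple; apply: connect_trans Y0.
  by rewrite (sym_connect_sym E_sym).
have QS b : b \in B -> Q b \in S.
  move=> bB; have [p pP] := connect_simple (T_conn _ _ (QW _ b0B) (QW b bB)).
  rewrite in_set QW //; apply/connectP; exists p; last by case: pP.
  exact: inner_path pP.
exists S.
  split; first by apply/subsetP => X; rewrite inE => /andP [].
  move=> X Y XS YS; have [p [pE plast puniq]] := S_conn X Y XS YS.
  exists p; first by split=> //; apply: ET.
  by move=> Z Zp; apply: (S_path X p) => //; rewrite inE Zp orbT.
split.
  rewrite subUset; apply/andP; split.
    apply/subsetP => b bB; apply/bigcupP; exists (Q b); first exact: QS.
    by case: (Q_choice bB).
  apply/bigcupsP => s; rewrite inE => /asboolP [b [c [p [bB cB pP sp]]]].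
  have [Y Yp Ys] := path_separators_source sp.
  have YS : Y \in S by apply: S_path (QS b bB) (inner_path bB cB pP) _ Yp.
  by apply: subset_trans (bigcap_inf Y Ys) (bigcup_sup Y YS).
move=> X Y XS YS XY; have [p [pE plast puniq]] := S_conn X Y XS YS.
apply/subsetP => a; rewrite inE => /andP [aX aY].
have SW Z : Z \in S -> Z \in max_cliques e by rewrite inE => /andP [].
have aP Z : Z \in X :: p -> a \in Z.
  by apply: (rip X Y p a (SW X XS) (SW Y YS) aX aY); split=> //; apply: ET.
(* As [X] and [Y] differ, the path has a first edge; it is an inner separator, and by running
   intersection both its ends contain [a]. *)
case: p pE plast puniq aP => [_ /= eXY|Z p /= /andP [/andP [_ XZ] _] _ _ aP].
  by rewrite eXY eqxx in XY.
rewrite inE; apply/orP; right; apply/bigcupP; exists [set X; Z] => //.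
by apply/bigcapP => W /set2P [->|->]; apply: aP; rewrite !inE eqxx ?orbT.
Qed.

End InnerSeparators.

Theorem theorem7 (R : realType) (A : finType) (F : {set {set A}})
    (T : rel {set A}) (B : {set A}) (Q : A -> {set A}) :
  antimonotonic F ->
  triangulated F ->
  clique_safe F ->
  connected_graph (dependency F) ->
  junction_tree (dependency F) T ->
  minimal_choice (dependency F) T B Q ->
  safe R F
    (B :|: \bigcup_(s in inner_separators T B Q) separator_items s).
Proof.
move=> F_anti _ F_safe _ jT [Q_choice _] theta freq q q_distr q_theta.
have e_sym : symmetric (dependency F).
  by move=> x y; rewrite /dependency eq_sym setUC.
have [S S_link S_sep] := inner_subtree jT Q_choice.
(* The property carried from [C] up to all of [A] is extendability of [q]. *)
have [p [p_distr p_q p_theta]] : extends_to F theta q [set: A].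
  apply: (simplicial_extension e_sym jT S_link S_sep).
    exact: extends_to_base.
  by move=> D v CD vD vclique; apply: extends_to_step.
by exists p; split=> // U UF; apply: p_theta.
Qed.
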